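(* In the genus 1 case, the group $\mathcal{H}$ is of order $6$ if and only if $$\begin{vmatrix}\Delta_{11}&\Delta_{21}&\Delta_{12}&\Delta_{22}\\ \Delta_{12}&\Delta_{22}&\Delta_{13}&\Delta_{23}\\ \Delta_{21}&\Delta_{31}&\Delta_{22}&\Delta_{32}\\ \Delta_{22}&\Delta_{32}&\Delta_{23}&\Delta_{33}\end{vmatrix}=0,$$ where $\Delta_{ij}$ denotes the cofactor of the $(i,j)$-th entry of the matrix $$\mathbb{P}=\begin{pmatrix} p_{11}&p_{10}&p_{1,-1}\\ p_{01}&p_{00}-1&p_{0,-1}\\ p_{-1,1}&p_{-1,0}&p_{-1,-1}\end{pmatrix}.$$
   Context: Let $p_{ij}\ge 0$, $-1\le i,j\le 1$, with $\sum_{i,j}p_{ij}=1$. Put $$Q(x,y)=xy\Big(1-\sum_{-1\le i,j\le 1}p_{ij}x^iy^j\Big).$$ Up to the sign of $Q$ (which is irrelevant, since only the curve $\{Q=0\}$ matters), $Q(x,y)=a(x)y^2+b(x)y+c(x)=\tilde a(y)x^2+\tilde b(y)x+\tilde c(y)$ with $a(x)=p_{1,1}x^2+p_{0,1}x+p_{-1,1}$, $b(x)=p_{1,0}x^2+(p_{0,0}-1)x+p_{-1,0}$, $c(x)=p_{1,-1}x^2+p_{0,-1}x+p_{-1,-1}$, $\tilde a(y)=p_{1,1}y^2+p_{1,0}y+p_{1,-1}$, $\tilde b(y)=p_{0,1}y^2+(p_{0,0}-1)y+p_{0,-1}$, $\tilde c(y)=p_{-1,1}y^2+p_{-1,0}y+p_{-1,-1}$.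 Standing assumption: $Q$ is irreducible of degree 2 in each variable and the algebraic curve $\{Q(x,y)=0\}$ has genus 1. Let $\mathbb{C}_Q(x,y)$ be the function field of this curve (the field of fractions of $\mathbb{C}[x,y]/(Q)$). Let $\xi,\eta$ be the $\mathbb{C}$-automorphisms of $\mathbb{C}_Q(x,y)$ determined by $\xi(x)=x$, $\xi(y)=\frac{c(x)}{y\,a(x)}$ and $\eta(y)=y$, $\eta(x)=\frac{\tilde c(y)}{x\,\tilde a(y)}$; they are involutions. The group of the random walk is $\mathcal{H}=\langle\xi,\eta\rangle$. Cofactors are signed: $\Delta_{ij}=(-1)^{i+j}$ times the minor obtained by deleting row $i$ and column $j$. *)

(* Defs.v *)
From HB Require Import structures.
From mathcomp Require Import all_boot all_order all_algebra.
From mathcomp Require Import boolp classical_sets cardinality reals.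
From mathcomp Require Import complex.
From mathcomp Require Import freeg.

Set Implicit Arguments.
Unset Strict Implicit.
Unset Printing Implicit Defensive.

Import GRing.Theory Num.Theory.

Local Open Scope classical_set_scope.
Local Open Scope ring_scope.

(* ['X] is the polynomial variable of the outer layer and ['Y := 'X%:P] that
   of the inner layer, so that [f.[x, y]] is the value of [f] at ['X = x] and
   ['Y = y]. *)
Definition eval2 (k K : fieldType) (iota : {rmorphism k -> K})
    (f : {poly {poly k}}) (x y : K) : K :=
  (map_poly (map_poly iota) f).[x, y].

Definition irreducible_elt (A : idomainType) (q : A) : Prop :=
  [/\ q != 0, q \isn't a GRing.unit &
      forall f g : A, q = f * g -> f \is a GRing.unit \/ g \is a GRing.unit].

(* A field of fractions of k[x, y]/(Q). The evaluation map k[x, y] -> K at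
   (x, y) has kernel (Q), and K is generated by its image as a field; this
   determines K, together with x, y and the embedding of k, up to a unique
   isomorphism. *)
Record function_field (k : fieldType) (Q : {poly {poly k}}) := FunctionField {
  ff_sort :> fieldType;
  ff_const : {rmorphism k -> ff_sort};
  ff_x : ff_sort;
  ff_y : ff_sort;
  ff_ker : forall f : {poly {poly k}},
    eval2 ff_const f ff_x ff_y = 0 <-> exists g, f = g * Q;
  ff_frac : forall z : ff_sort, exists f g : {poly {poly k}},
    eval2 ff_const g ff_x ff_y != 0 /\
    z = eval2 ff_const f ff_x ff_y / eval2 ff_const g ff_x ff_y }.

Definition is_automorphism (k : fieldType) (Q : {poly {poly k}})
    (F : function_field Q) (s : {rmorphism F -> F}) : Prop :=
  bijective s /\ forall c : k, s (ff_const F c) = ff_const F c.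

Definition transformation_group (T : Type) (G : set (T -> T)) : Prop :=
  [/\ G id,
      forall f g, G f -> G g -> G (f \o g) &
      forall f g, G f -> cancel f g -> cancel g f -> G g].

Definition generated_group (T : Type) (S : set (T -> T)) : set (T -> T) :=
  smallest (@transformation_group T) S.

(* The places of K/k, given by their normalized discrete valuations. The
   valuation of 0 is +oo; the convention [valuation 0 = 0] is only there to
   have exactly one valuation function for each place. *)
Record place (k K : fieldType) (iota : {rmorphism k -> K}) := Place {
  valuation : K -> int;
  valuation0 : valuation 0 = 0;
  valuation_const : forall c : k, valuation (iota c) = 0;
  valuationM : forall f g : K, f != 0 -> g != 0 ->
    valuation (f * g) = valuation f + valuation g;
  valuationD : forall f g : K, f != 0 -> g != 0 -> f + g != 0 ->
    Num.min (valuation f) (valuation g) <= valuation (f + g);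
  valuation_uniformizer : exists t : K, t != 0 /\ valuation t = 1 }.

HB.instance Definition _ (k K : fieldType) (iota : {rmorphism k -> K}) :=
  gen_eqMixin (place iota).
HB.instance Definition _ (k K : fieldType) (iota : {rmorphism k -> K}) :=
  gen_choiceMixin (place iota).

Definition riemann_roch_space (k K : fieldType) (iota : {rmorphism k -> K})
    (D : {freeg place iota}) : set K :=
  [set f | f = 0 \/ forall P : place iota, - coeff P D <= valuation P f].

Definition has_dim (k K : fieldType) (iota : {rmorphism k -> K})
    (V : set K) (n : nat) : Prop :=
  exists e : 'I_n -> K,
    [/\ forall i, V (e i),
        forall c : 'I_n -> k,
          \sum_(i < n) iota (c i) * e i = 0 -> forall i, c i = 0 &
        forall f, V f ->
          exists c : 'I_n -> k, f = \sum_(i < n) iota (c i) * e i].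

(* g = max_D (deg D - l(D) + 1), where D ranges over the divisors of K/k and
   l(D) is the dimension of L(D) over k. As k is algebraically closed, every
   place has degree 1, so deg D is the sum of the coefficients of D. *)
Definition has_genus (k : closedFieldType) (K : fieldType)
    (iota : {rmorphism k -> K}) (g : nat) : Prop :=
  (exists (D : {freeg place iota}) (l : nat),
     has_dim iota (riemann_roch_space D) l /\ deg D - l%:Z + 1 = g%:Z) /\
  (forall (D : {freeg place iota}) (l : nat),
     has_dim iota (riemann_roch_space D) l -> deg D - l%:Z + 1 <= g%:Z).

Section Kernel.
Variable R : realType.

(* The indices 0, 1, 2 of ['I_3] stand for the jumps -1, 0, 1: [p i j] is the
   probability of the jump (i - 1, j - 1). *)
Implicit Type p : 'I_3 -> 'I_3 -> R.

Definition is_jump_distribution p : Prop :=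
  (forall i j, 0 <= p i j) /\ \sum_i \sum_j p i j = 1.

(* xy (1 - sum p_{ij} x^i y^j), with x y x^i y^j = x^(i+1) y^(j+1) *)
Definition kernel_poly p : {poly {poly R[i]}} :=
  'X * 'Y - \sum_(i < 3) \sum_(j < 3) (p i j)%:C%C%:P%:P * 'X ^+ i * 'Y ^+ j.

Definition kernel_a p : {poly R[i]} := \sum_(i < 3) (p i 2)%:C%C *: 'X ^+ i.
Definition kernel_c p : {poly R[i]} := \sum_(i < 3) (p i 0)%:C%C *: 'X ^+ i.
Definition kernel_ta p : {poly R[i]} := \sum_(j < 3) (p 2 j)%:C%C *: 'X ^+ j.
Definition kernel_tc p : {poly R[i]} := \sum_(j < 3) (p 0 j)%:C%C *: 'X ^+ j.

Definition is_xi p (F : function_field (kernel_poly p))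
    (xi : {rmorphism F -> F}) : Prop :=
  [/\ is_automorphism xi,
      xi (ff_x F) = ff_x F &
      xi (ff_y F) = (map_poly (ff_const F) (kernel_c p)).[ff_x F] /
                    (ff_y F * (map_poly (ff_const F) (kernel_a p)).[ff_x F])].

Definition is_eta p (F : function_field (kernel_poly p))
    (eta : {rmorphism F -> F}) : Prop :=
  [/\ is_automorphism eta,
      eta (ff_y F) = ff_y F &
      eta (ff_x F) = (map_poly (ff_const F) (kernel_tc p)).[ff_y F] /
                     (ff_x F * (map_poly (ff_const F) (kernel_ta p)).[ff_y F])].

(* Rows and columns are listed by decreasing jumps 1, 0, -1. *)
Definition jump_matrix p : 'M[R]_3 :=
  \matrix_(i, j) (p (rev_ord i) (rev_ord j) - ((i == 1) && (j == 1))%:R).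

(* The cofactor of the (i, j)-th entry, with 1 <= i, j <= 3. *)
Definition Delta p (i j : nat) : R :=
  cofactor (jump_matrix p) (inord i.-1) (inord j.-1).

Definition order6_matrix p : 'M[R]_4 :=
  let D := Delta p in
  \matrix_(i, j) nth 0 (nth [::]
    [:: [:: D 1 1; D 2 1; D 1 2; D 2 2];
        [:: D 1 2; D 2 2; D 1 3; D 2 3];
        [:: D 2 1; D 3 1; D 2 2; D 3 2];
        [:: D 2 2; D 3 2; D 2 3; D 3 3]]%N i) j.

End Kernel.

(* Main.v *)
Require Import Defs.
From mathcomp Require Import all_boot all_order all_algebra.
From mathcomp Require Import boolp classical_sets cardinality reals.
From mathcomp Require Import complex.
From mathcomp Require Import perm polyXY zify ring.

(** Let [P] be the jump matrix, [C] the matrix of its cofactors and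
    [v(t) = (t^2, t, 1)], so that the kernel is [Q(x, y) = - v(x) P v(y)^T].
    Let [L] be the linear functional on the polynomials of degree at most 2 in
    [s] and in [t] with [L(s^(2-i) t^(2-j)) = C_ij]. The 4 x 4 matrix is the
    matrix of the bilinear form [L(f g)] on the span of [st, s, t, 1], so its
    determinant vanishes iff [L(f g) = 0] for some nonzero bilinear polynomial
    [f] and all bilinear [g].

    As [xi] and [eta] are distinct nontrivial involutions, their group is
    dihedral, and it has order 6 iff [(xi eta)^3 = 1]
    ([card_generated_involutions_eq6]).

    Suppose [(xi eta)^3 = 1]. The images of the generic point [(x, y)] form a
    hexagon on the curve: with [x_0, x_1, x_2 = x, eta x, xi eta x] and
    [y_0, y_1, y_2 = y, xi y, eta xi y], the point [(x_k, y_l)] is on the curve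
    unless [k + l = 2]. In the bases given by the [v(x_k)] and the [v(y_l)] the
    matrix [P] is therefore antidiagonal, hence so is its inverse, which says
    that [L] is a combination of the evaluations at the three points
    [(x_k, y_(2-k))]. The form [L(f g)] then has rank at most 3
    ([det_bihankel_hexagon]).

    Conversely, let [f] be in the kernel of the form. As [v(x) P] lists the
    coefficients of a multiple of [(t - y)(t - xi y)], the number
    [L(h(s)(t - y)(t - xi y))] is proportional to [h(x)]. Modulo [f], the factor
    [t - y] can be traded for [f(s, y)], and so [L((s - x) f(s, y) g(t))] is
    proportional to [g(xi y)] ([contracted_cofactor]). Contracting with [P]
    gives that [det P (s - x) f(s, y)] is proportional to [Q(s, xi y)], that is
    to [(s - x)(s - xi eta x)] ([det_contracted]). If [det P] is not 0, then
    [f(xi eta x, y) = 0]: as this equation determines [xi eta x] from [y], it is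
    fixed by [eta], whence [(xi eta)^3 x = x], and [(xi eta)^3 y = y] by solving
    the same equation for [y] ([det_eq0_rotation_order3]). If [det P = 0], the
    contraction itself vanishes; this forces a nonzero column of [C], which is
    in the left kernel of [P], to be a multiple of some [v(z)] or of
    [(1, 0, 0)]. Then [x - z] divides [Q], or [Q] has degree less than 2 in [x]
    ([slice_contraction_neq0]). *)

Set Implicit Arguments.
Unset Strict Implicit.
Unset Printing Implicit Defensive.
Import GRing.Theory Num.Theory.
Local Open Scope classical_set_scope.
Local Open Scope ring_scope.
Local Open Scope card_scope.

(** * Groups generated by two involutions *)

Section Dihedral.
Variables (T : Type) (s t : T -> T).
Hypotheses (sK : involutive s) (tK : involutive t).

Local Notation r := (s \o t).

(** The alternating words [1, s, st, sts, ...], by length: the word of even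
    length [2m] is a power of the rotation [st], that of length [2m + 1] is a
    reflection. *)
Definition dihedral_word (k : nat) : T -> T := iter k./2 r \o iter (odd k) s.

Lemma iter_rotation_inj m : injective (iter m r).
Proof.
by elim: m => [|m IH] u v //= /(can_inj sK) /(can_inj tK) /IH.
Qed.

(** A reflection conjugates a rotation into its inverse. *)
Lemma iter_rotation_conj m z : iter m r (s (iter m r z)) = s z.
Proof.
by elim: m z => [|m IH] z //; rewrite iterSr /= sK tK IH.
Qed.

Lemma dihedral_word_generated k : generated_group [set s; t] (dihedral_word k).
Proof.
move=> G [[G1 GM GV] sG].
have [Gs Gt] : G s /\ G t by split; apply: sG; [left|right].
apply: (GM); last by case: (odd k).
by elim: (k./2) => [//|m IH] /=; apply: (GM) (GM _ _ Gs Gt) IH.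
Qed.

(** When the rotation has finite order, its inverse is one of its powers, so the
    words of length less than [2n] already form a group. *)
Lemma generated_group_dihedral n : (0 < n)%N -> iter n r =1 id ->
  generated_group [set s; t] = dihedral_word @` `I_n.*2.
Proof.
move=> n_gt0 rn1.
have rmuln m : iter (m * n) r =1 id.
  by elim: m => [|m IH] z //; rewrite mulSn iterD rn1 IH.
have wordE i (b : bool) : (dihedral_word @` `I_n.*2) (iter i r \o iter b s).
  exists ((i %% n).*2 + b)%N; first by have := ltn_pmod i n_gt0; case: b => /=; lia.
  rewrite /dihedral_word addnC half_bit_double oddD odd_double addbF.
  apply: funext => z /=; rewrite {2}(divn_eq i n) iterD rmuln.
  by case: b.
have s_iter j z : s (iter j r z) = iter (j * n.-1) r (s z).
  apply: (@iter_rotation_inj j).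
  by rewrite iter_rotation_conj -iterD -mulnS prednK // rmuln.
have word_group : transformation_group (dihedral_word @` `I_n.*2).
  split=> [|f g [k _ <-] [l _ <-]|f g [k _ <-] fgK gfK].
  - exact: (wordE 0 false).
  - rewrite /dihedral_word; case: (odd k) => /=; last first.
      have := wordE (k./2 + l./2) (odd l); congr (_ _).
      by apply: funext => z /=; rewrite iterD.
    have := wordE (k./2 + l./2 * n.-1) (~~ odd l); congr (_ _).
    apply: funext => z /=; rewrite s_iter iterD.
    by case: (odd l) => //=; rewrite sK.
  - suff [i [b ib]] : exists i (b : bool),
        cancel (iter i r \o iter b s) (dihedral_word k).
      suff -> : g = iter i r \o iter b s by exact: wordE.
      by apply: funext => z; rewrite -{1}[z]ib fgK.
    rewrite /dihedral_word; case: (odd k).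
      by exists k./2, true => z /=; rewrite iter_rotation_conj sK.
    exists (k./2 * n.-1), false => z /=.
    by rewrite -iterD -mulnS prednK // rmuln.
rewrite eqEsubset; split=> [|_ [k _ <-]]; last exact: dihedral_word_generated.
apply: smallest_sub => // _ [->|->]; first exact: (wordE 0%N true).
suff -> : t = iter n.-1 r \o iter true s by exact: wordE.
by apply: funext => z; rewrite -{1}[t z]rn1 -{1}(prednK n_gt0) iterSr /= tK.
Qed.

Hypotheses (s_neq_id : ~ s =1 id) (t_neq_id : ~ t =1 id).

(** If [s] were the power [r^m] of the rotation, then splitting [r^m] in the
    middle and using [r^e s r^e = s] would make [s] (for [m = 2e]) or [t] (for
    [m = 2e + 1]) trivial. *)
Lemma iter_rotation_neq_reflection m : ~ iter m r =1 s.
Proof.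
move=> rms.
have onto e w : iter e r (s (iter e r (s w))) = w.
  by rewrite iter_rotation_conj sK.
move: rms; rewrite -(odd_double_half m); set e := m./2.
case: (odd m) => rms.
  apply: t_neq_id => w; rewrite -[w](onto e); move: (s (iter e r (s w))) => v.
  apply: (can_inj sK); apply: (@iter_rotation_inj e).
  by rewrite iter_rotation_conj -(rms v) -addnn addnA iterD; apply/esym/iterSr.
apply: s_neq_id => w; rewrite -[w](onto e); move: (s (iter e r (s w))) => v.
apply: (@iter_rotation_inj e).
by rewrite iter_rotation_conj -(rms v) -addnn addnA iterD.
Qed.

Lemma dihedral_word_eq i j : (i < j)%N -> dihedral_word i = dihedral_word j ->
  exists m, [/\ (0 < m)%N, (m.*2 <= j - i)%N & iter m r =1 id].
Proof.
rewrite /dihedral_word => ltij eij.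
have leij : (i./2 <= j./2)%N by lia.
have shift z : iter (odd i) s z = iter (j./2 - i./2) r (iter (odd j) s z).
  apply: (@iter_rotation_inj i./2).
  by rewrite -iterD subnKC //; exact: (congr1 (@^~ z) eij).
case oi: (odd i) shift; case oj: (odd j) => /= shift.
- exists (j./2 - i./2)%N; split; [lia|lia|move=> z].
  by rewrite -[z]sK -shift.
- by case: (@iter_rotation_neq_reflection (j./2 - i./2)).
- case: (@iter_rotation_neq_reflection (j./2 - i./2)) => z.
  by rewrite [RHS]shift sK.
- by exists (j./2 - i./2)%N; split; [lia|lia|].
Qed.

Lemma card_dihedral_words n :
  (forall m, (0 < m)%N -> (m.*2 < n)%N -> ~ iter m r =1 id) ->
  dihedral_word @` `I_n #= `I_n.
Proof.
move=> r_ord; apply: inj_card_eq.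
have inj i j : (i < j < n)%N -> dihedral_word i <> dihedral_word j.
  move=> /andP[ij jn] /(dihedral_word_eq ij) [m [m_gt0 m_le]].
  by apply: r_ord => //; lia.
move=> i j; rewrite !inE /= => iltn jltn e.
by case: (ltngtP i j) => // ij; [case: (inj i j)|case: (inj j i)]; rewrite ?ij.
Qed.

Hypothesis s_neq_t : ~ s =1 t.

(** If the rotation has order 1 the involutions coincide, if it has order 2 the
    group has at most 4 elements, and if its first three powers are nontrivial
    there are 7 distinct words of length at most 6. *)
Lemma card_generated_involutions_eq6 :
  generated_group [set s; t] #= `I_6 <-> iter 3 r =1 id.
Proof.
have r1 : ~ iter 1 r =1 id.
  by move=> e; apply: s_neq_t => z; rewrite -[t z]e /= tK.
split=> [card6|r3]; last first.
  rewrite (generated_group_dihedral (n := 3)) //.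
  apply: card_dihedral_words => -[|[|[|m]]] // _ _ r2.
  by apply: r1 => z; rewrite -{2}[z]r3 /= -[RHS]/(iter 2 r (r z)) r2.
apply: contrapT => r3.
have [r2|r2] := pselect (iter 2 r =1 id).
  have : `I_6 #<= `I_4.
    rewrite -(card_le_eql card6) (generated_group_dihedral (n := 2)) //.
    exact: card_image_le.
  by rewrite card_le_II.
have : `I_7 #<= `I_6.
  rewrite -(card_le_eqr card6) -(card_le_eql (card_dihedral_words _)).
    by apply: subset_card_le => _ [k _ <-]; apply: dihedral_word_generated.
  by move=> [|[|[|[|m]]]].
by rewrite card_le_II.
Qed.
End Dihedral.

(** * Rows of powers and the matrix of cofactors *)

Lemma sum_ord3 (V : nmodType) (F : 'I_3 -> V) : \sum_i F i = F 0 + F 1 + F 2.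
Proof.
rewrite !big_ord_recl big_ord0 addr0 addrA.
by congr (F _ + F _ + F _); apply: val_inj.
Qed.

Lemma sum_ord4 (V : nmodType) (F : 'I_4 -> V) : \sum_i F i = F 0 + F 1 + F 2 + F 3.
Proof.
rewrite !big_ord_recl big_ord0 addr0 !addrA.
by congr (F _ + F _ + F _ + F _); apply: val_inj.
Qed.

Lemma forall_ord3 (P : 'I_3 -> Prop) : P 0 -> P 1 -> P 2 -> forall i, P i.
Proof.
move=> P0 P1 P2 [[|[|[|//]]] i3];
  [move: P0|move: P1|move: P2]; congr (P _); exact: val_inj.
Qed.

Lemma cV4_eq0 (V : nmodType) (f : 'cV[V]_4) :
  f 0 0 = 0 -> f 1 0 = 0 -> f 2 0 = 0 -> f 3 0 = 0 -> f = 0.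
Proof.
move=> f0 f1 f2 f3; apply/colP => i; rewrite mxE.
case: i => -[|[|[|[|//]]]] i4;
  [rewrite -[RHS]f0|rewrite -[RHS]f1|rewrite -[RHS]f2|rewrite -[RHS]f3];
  by congr (f _ _); apply: val_inj.
Qed.

(** The pairing of a row of coefficients with [mono t] evaluates at [t] a
    polynomial of degree at most 2, listed from the leading coefficient; the rows
    and columns of the jump matrix are listed in this order. *)
Definition mono (K : pzRingType) (t : K) : 'rV[K]_3 := \row_i t ^+ (2 - i).

(** The coefficients of the monic quadratic polynomial with roots [u] and [v]. *)
Definition quad (K : pzRingType) (u v : K) : 'rV[K]_3 :=
  \row_i nth 0 [:: 1; - (u + v); u * v] i.

(** The matrix of the form [L(g f)], where [L(s^(2-i) t^(2-j)) = C i j]: the rows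
    stand for [g = st, s, t, 1] and the columns for [f = st, t, s, 1]. As the two
    orders differ, it need not be symmetric. *)
Definition bihankel (K : Type) (C : 'M[K]_3) : 'M[K]_4 :=
  \matrix_(r, c) C (inord (r./2 + odd c)) (inord (odd r + c./2)).

Definition cofactor_mx (K : comPzRingType) (N : 'M[K]_3) : 'M[K]_3 :=
  \matrix_(i, j) cofactor N i j.

Lemma order6_matrixE (R : realType) (p : 'I_3 -> 'I_3 -> R) :
  order6_matrix p = bihankel (cofactor_mx (jump_matrix p)).
Proof.
apply/matrixP => i j; rewrite !mxE.
by case: i j => -[|[|[|[|]]]] // ? [] [|[|[|[|]]]].
Qed.

Lemma map_bihankel_cofactor_mx (K L : comNzRingType) (f : {rmorphism K -> L})
    (N : 'M[K]_3) :
  map_mx f (bihankel (cofactor_mx N)) = bihankel (cofactor_mx (map_mx f N)).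
Proof. by apply/matrixP => i j; rewrite !mxE cofactor_map_mx. Qed.

(** * Hexagons on a biquadratic curve *)

Section Hexagon.
Variable K : fieldType.

Definition moment_mx (x : 'I_3 -> K) : 'M[K]_3 := \matrix_k mono (x k).

Lemma moment_mx_unit x : injective x -> moment_mx x \in unitmx.
Proof.
move=> x_inj.
have -> : moment_mx x =
    (row_perm (perm (@rev_ord_inj 3)) (Vandermonde 3 (\row_k x k)))^T.
  by apply/matrixP => k i; rewrite !mxE permE.
rewrite unitmx_tr row_permE unitmx_mul unitmx_perm unitmxE det_Vandermonde unitfE.
apply/prodf_neq0 => i _; apply/prodf_neq0 => j ltij.
by rewrite !mxE subr_eq0 (inj_eq x_inj) neq_ltn ltij orbT.
Qed.

Lemma det_mulmx_rank_deficient m n (A : 'M[K]_(m, n)) (B : 'M[K]_(n, m)) :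
  (n < m)%N -> \det (A *m B) = 0.
Proof.
move=> ltnm; apply: contraTeq ltnm; rewrite -unitfE -unitmxE -row_full_unit -leqNgt.
by move/eqP <-; apply: mulmx_max_rank.
Qed.

(** The second vanishing hypothesis says that [(x_k, y_l)] is on the curve unless
    [k + l = 2]. Then [N] is antidiagonal in two bases of rows of powers, so its
    cofactors are a sum of three products [x_k^(2-i) y_(2-k)^(2-j)], and the
    4 x 4 matrix factors through a space of dimension 3. The first hypothesis
    makes the antidiagonal entries nonzero. *)
Lemma det_bihankel_hexagon (N : 'M[K]_3) (x y : 'I_3 -> K) :
  injective x -> injective y ->
  (forall k, (moment_mx x *m N) k 0 != 0) ->
  (forall k l, k != rev_ord l -> (moment_mx x *m N *m (moment_mx y)^T) k l = 0) ->
  \det (bihankel (cofactor_mx N)) = 0.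
Proof.
move=> /moment_mx_unit Xu /moment_mx_unit Yu a_neq0.
move: {-2}(_ *m _ *m _) (erefl (moment_mx x *m N *m (moment_mx y)^T)) => D DE D0.
have YTu : (moment_mx y)^T \in unitmx by rewrite unitmx_tr.
have D_neq0 k : D k (rev_ord k) != 0.
  apply: contra (a_neq0 k) => /eqP Dk.
  have -> : (moment_mx x *m N) k 0 = row k (D *m invmx (moment_mx y)^T) 0 0.
    by rewrite DE mulmxK // [RHS]mxE.
  rewrite row_mul (_ : row k D = 0) ?mul0mx ?mxE //.
  apply/rowP => l; rewrite !mxE.
  have [->|kl] := eqVneq l (rev_ord k); first exact: Dk.
  by apply: D0; apply: contra kl => /eqP ->; rewrite rev_ordK.
have mulD (A : 'M[K]_3) k m : (D *m A) k m = D k (rev_ord k) * A (rev_ord k) m.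
  rewrite mxE (bigD1 (rev_ord k)) //= big1 ?addr0 // => l kl.
  by rewrite D0 ?mul0r //; apply: contra kl => /eqP ->; rewrite rev_ordK.
have Du : D \in unitmx.
  rewrite unitmxE unitfE; apply/negP => /det0P [u /negP u0 uD]; apply: u0.
  apply/eqP/rowP => k; rewrite [RHS]mxE; apply: (mulIf (D_neq0 k)); rewrite mul0r.
  move/rowP: uD => /(_ (rev_ord k)).
  rewrite !mxE (bigD1 k) //= big1 ?addr0 // => l kl.
  by rewrite D0 ?mulr0 // rev_ordK.
have Nu : N \in unitmx by move: Du; rewrite DE !unitmx_mul Xu YTu andbT.
have Vinv k m : k != m -> invmx D (rev_ord k) m = 0.
  move=> km; apply: (mulfI (D_neq0 k)); rewrite -mulD mulmxV // !mxE mulr0.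
  by rewrite (negPf km).
(* the weights of the evaluations at [(x_k, y_(2-k))] *)
pose d k := \det N * invmx D (rev_ord k) k.
have CE i j : cofactor N i j = \sum_k d k * x k ^+ (2 - i) * y (rev_ord k) ^+ (2 - j).
  have -> : cofactor N i j = \det N * invmx N j i.
    by rewrite /invmx Nu !mxE mulrA divff ?mul1r // -unitfE -unitmxE.
  have -> : invmx N = (moment_mx y)^T *m (invmx D *m moment_mx x).
    apply: (can_inj (mulKmx Nu)); rewrite mulmxV // !mulmxA; apply/esym/mulmx1C.
    by rewrite !mulmxA -DE mulmxV.
  rewrite mxE mulr_sumr (reindex_inj (@rev_ord_inj 3)) /=.
  apply: eq_bigr => k _; rewrite !mxE (bigD1 k) //= big1 => [|m mk].
    by rewrite !mxE /d; ring.
  by rewrite Vinv ?mul0r // eq_sym.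
pose A := \matrix_(r < 4, k < 3) (x k ^+ (1 - r./2) * y (rev_ord k) ^+ (1 - odd r)).
pose B := \matrix_(k < 3, c < 4)
  (d k * x k ^+ (1 - odd c) * y (rev_ord k) ^+ (1 - c./2)).
suff -> : bihankel (cofactor_mx N) = A *m B by apply: det_mulmx_rank_deficient.
apply/matrixP => r c; rewrite !mxE CE; apply: eq_bigr => k _; rewrite !mxE.
have [r4 c4] := (ltn_ord r, ltn_ord c).
rewrite !inordK; [|lia|lia].
rewrite (_ : 2 - (r./2 + odd c) = 1 - r./2 + (1 - odd c))%N; last by lia.
rewrite (_ : 2 - (odd r + c./2) = 1 - odd r + (1 - c./2))%N; last by lia.
by rewrite !exprD; ring.
Qed.
End Hexagon.

(** * Kernel vectors of the cofactor matrix *)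

(** The equations [L(f g) = 0] for [g = st, s, t, 1], where a column [f] stands
    for the polynomial [f 0 st + f 1 t + f 2 s + f 3]. *)
Lemma bihankel_mul (K : nzSemiRingType) (C : 'M[K]_3) (f : 'cV[K]_4) :
  bihankel C *m f = 0 ->
  [/\ C 0 0 * f 0 0 + C 1 0 * f 1 0 + C 0 1 * f 2 0 + C 1 1 * f 3 0 = 0,
      C 0 1 * f 0 0 + C 1 1 * f 1 0 + C 0 2 * f 2 0 + C 1 2 * f 3 0 = 0,
      C 1 0 * f 0 0 + C 2 0 * f 1 0 + C 1 1 * f 2 0 + C 2 1 * f 3 0 = 0 &
      C 1 1 * f 0 0 + C 2 1 * f 1 0 + C 1 2 * f 2 0 + C 2 2 * f 3 0 = 0].
Proof.
move=> Cf; have row_eq0 r : (bihankel C *m f) r 0 = 0 by rewrite Cf mxE.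
by split; [rewrite -[RHS](row_eq0 0)|rewrite -[RHS](row_eq0 1)
          |rewrite -[RHS](row_eq0 2)|rewrite -[RHS](row_eq0 3)];
  rewrite mxE sum_ord4 !mxE;
  congr (C _ _ * _ + C _ _ * _ + C _ _ * _ + C _ _ * _);
  apply: val_inj; rewrite /= inordK.
Qed.

(** For a bilinear polynomial [f(s, t)], the coefficients of [s] and of 1 in
    [f(s, t)] at a given [t], and the coefficients of [(s - u) f(s, t)]. *)
Definition slice_lead (K : pzRingType) (f : 'cV[K]_4) (t : K) : K := f 0 0 * t + f 2 0.

Definition slice_const (K : pzRingType) (f : 'cV[K]_4) (t : K) : K := f 1 0 * t + f 3 0.

Definition slice_mul_root (K : pzRingType) (f : 'cV[K]_4) (t u : K) : 'rV[K]_3 :=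
  \row_i nth 0 [:: slice_lead f t; slice_const f t - u * slice_lead f t;
                   - (u * slice_const f t)] i.

Section Closing.
Variables (K : fieldType) (N : 'M[K]_3) (f : 'cV[K]_4) (x x2 y y1 alpha beta : K).
Let C := cofactor_mx N.

Hypothesis Cf : bihankel C *m f = 0.
Hypothesis alpha_neq0 : alpha != 0.
Hypothesis Nx : mono x *m N = alpha *: quad y y1.
Hypothesis Ny1 : N *m (mono y1)^T = beta *: (quad x x2)^T.

Local Notation q := (slice_mul_root f y x).

(** [L(h(s)(t - y)(t - y1))] is proportional to [h(x)]. *)
Lemma quad_cofactor : quad y y1 *m C^T = (\det N / alpha) *: mono x.
Proof.
apply: (scalerI alpha_neq0); rewrite scalemxAl -Nx scalerA mulrCA mulfV // mulr1.
rewrite -mulmxA (_ : C^T = \adj N); last by apply/matrixP => i j; rewrite !mxE.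
by rewrite mul_mx_adj mul_mx_scalar.
Qed.

(** [L((s - x) f(s, y) g(t))] is proportional to [g(y1)]. Indeed, for a linear
    [l(t) = a + b t] there is a linear [l'(s)] with
    [f(s, y) l(t) = - (t - y) l'(s) + l(y) f(s, t)]; after multiplication by
    [(s - x)(t - y1)], the first term is killed by [L] by [quad_cofactor], and
    the second because [f] is in the kernel of the form. *)
Lemma contracted_cofactor : exists delta, q *m C = delta *: mono y1.
Proof.
have E i : C i 0 - (y + y1) * C i 1 + y * y1 * C i 2 = \det N / alpha * x ^+ (2 - i).
  have /rowP/(_ i) := quad_cofactor; rewrite mxE sum_ord3 !mxE /= => <-.
  by ring.
set kappa := _ / _ in E.
have [r1 r2 r3 r4] := bihankel_mul Cf.
pose e i := C i 0 - (y + y1) * C i 1 + y * y1 * C i 2.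
(* [L(f g)] for [g = (s - x)(t - y1)] *)
pose Lfg := (C 0 0 * f 0 0 + C 1 0 * f 1 0 + C 0 1 * f 2 0 + C 1 1 * f 3 0)
  - y1 * (C 0 1 * f 0 0 + C 1 1 * f 1 0 + C 0 2 * f 2 0 + C 1 2 * f 3 0)
  - x * (C 1 0 * f 0 0 + C 2 0 * f 1 0 + C 1 1 * f 2 0 + C 2 1 * f 3 0)
  + x * y1 * (C 1 1 * f 0 0 + C 2 1 * f 1 0 + C 1 2 * f 2 0 + C 2 2 * f 3 0).
have Lfg0 : Lfg = 0 by rewrite /Lfg r1 r2 r3 r4; ring.
(* [L((s - x)(a s + b)(t - y)(t - y1)) = 0] *)
have L0 a b : (a * e 0 + (b - x * a) * e 1 - x * b * e 2) = 0.
  by rewrite /e !E /=; ring.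
(* [l = 1], with [l'(s) = f 0 s + f 1] *)
have D12 : (q *m C) 0 1 - y1 * (q *m C) 0 2 = 0.
  rewrite -[RHS](_ :
    - (f 0 0 * e 0 + (f 1 0 - x * f 0 0) * e 1 - x * f 1 0 * e 2) + Lfg = 0).
    by rewrite /e /Lfg !mxE !sum_ord3 !mxE /= /slice_lead /slice_const; ring.
  by rewrite L0 Lfg0 addr0 oppr0.
(* [l = t], with [l'(s) = - (f 2 s + f 3)] *)
have D01 : (q *m C) 0 0 - y1 * (q *m C) 0 1 = 0.
  rewrite -[RHS](_ :
    f 2 0 * e 0 + (f 3 0 - x * f 2 0) * e 1 - x * f 3 0 * e 2 + y * Lfg = 0).
    by rewrite /e /Lfg !mxE !sum_ord3 !mxE /= /slice_lead /slice_const; ring.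
  by rewrite L0 Lfg0 mulr0 addr0.
move/eqP: D12; rewrite subr_eq0 => /eqP D12.
move/eqP: D01; rewrite subr_eq0 D12 => /eqP D01.
exists ((q *m C) 0 2); apply/rowP.
apply: forall_ord3; rewrite [RHS]mxE [mono _ _ _]mxE /= ?expr1 ?expr0 ?mulr1 //.
- by rewrite D01; ring.
- by rewrite D12 mulrC.
Qed.

(** The cofactors invert [N] up to [\det N], and [N] sends [mono y1] to the
    quadratic polynomial with roots [x] and [x2]: hence [\det N (s - x) f(s, y)]
    is a multiple of [(s - x)(s - x2)]. *)
Lemma det_contracted : exists delta,
 q *m C = delta *: mono y1 /\ \det N *: q = (delta * beta) *: quad x x2.
Proof.
have [delta qC] := contracted_cofactor; exists delta; split=> //.
have -> : \det N *: q = q *m C *m N^T.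
  rewrite -mulmxA (_ : C *m N^T = (\det N)%:M) ?mul_mx_scalar //.
  rewrite -[C]trmxK -trmx_mul (_ : C^T = \adj N) ?mul_mx_adj ?tr_scalar_mx //.
  by apply/matrixP => i j; rewrite !mxE.
rewrite qC -scalemxAl -[mono y1]trmxK -trmx_mul Ny1 -scalerA.
by apply/rowP => i; rewrite !mxE.
Qed.
End Closing.

(** * Biquadratic polynomials *)

Section Biquadratic.
Variable k : fieldType.
Implicit Types A : 'M[k]_3.

Definition biquadratic A : {poly {poly k}} :=
  \sum_i (\sum_j A i j *: 'X^(2 - j)) *: 'X^(2 - i).

Lemma coef_biquadratic_sum A m n :
  (biquadratic A)`_m`_n = \sum_i \sum_j A i j * (n == 2 - j)%N%:R * (m == 2 - i)%N%:R.
Proof.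
rewrite !coef_sum; apply: eq_bigr => i _.
rewrite coefZ coefXn mulr_natr coefMn coef_sum -sumrMnl.
by apply: eq_bigr => j _; rewrite coefZ coefXn [RHS]mulr_natr.
Qed.

Lemma coef_biquadratic A (i j : 'I_3) : (biquadratic A)`_(2 - i)`_(2 - j) = A i j.
Proof.
have eq2 (a b : 'I_3) : (2 - a == 2 - b)%N = (b == a).
  have [a3 b3] := (ltn_ord a, ltn_ord b).
  by apply/eqP/eqP => [e|-> //]; apply: val_inj => /=; lia.
rewrite coef_biquadratic_sum (bigD1 i) //= (bigD1 j) //= !eqxx !mulr1 !big1 ?addr0 //.
  by move=> i' ne; rewrite big1 // => j' _; rewrite (eq2 i i') (negPf ne) mulr0.
by move=> j' ne; rewrite (eq2 j j') (negPf ne) mulr0 mul0r.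
Qed.

Lemma biquadratic_eq0 A : biquadratic A = 0 -> A = 0.
Proof. by move=> A0; apply/matrixP => i j; rewrite -coef_biquadratic A0 !coef0 mxE. Qed.

Lemma swapXY_biquadratic A : swapXY (biquadratic A) = biquadratic A^T.
Proof.
apply/polyP => m; apply/polyP => n.
rewrite coef_swapXY !coef_biquadratic_sum exchange_big.
by apply: eq_bigr => i _; apply: eq_bigr => j _; rewrite mxE mulrAC.
Qed.

Lemma size_biquadratic_lt3 A : (forall j, A 0 j = 0) -> (size (biquadratic A) < 3)%N.
Proof.
move=> A0; rewrite ltnS; apply/leq_sizeP => -[|[|m]] // _; apply/polyP => n.
rewrite coef0 coef_biquadratic_sum big1 // => i _; apply: big1 => j _.
by case: i => -[|i] i3; [rewrite (_ : Ordinal i3 = 0) ?A0 ?mul0r //; apply: val_inj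
  |rewrite (_ : (m.+2 == 2 - i.+1)%N = false) ?mulr0 //; lia].
Qed.

Lemma eval2_biquadratic (K : fieldType) (iota : {rmorphism k -> K}) A x y :
  eval2 iota (biquadratic A) x y = (mono x *m map_mx iota A *m (mono y)^T) 0 0.
Proof.
rewrite /eval2 rmorph_sum !horner_sum /= -mulmxA mxE; apply: eq_bigr => i _.
rewrite map_polyZ /= map_polyXn !hornerE /= mulrC mxE rmorph_sum /= horner_sum.
rewrite [in RHS]mxE; congr (_ * _).
apply: eq_bigr => j _; rewrite map_polyZ /= map_polyXn !hornerE !mxE //.
Qed.

Lemma horner_biquadratic A z :
  (biquadratic A).[z%:P] = \sum_j (mono z *m A) 0 j *: 'X^(2 - j).
Proof.
rewrite horner_sum /=.
transitivity (\sum_(i < 3) \sum_(j < 3)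
    (z ^+ (2 - i) * A i j) *: (('X : {poly k}) ^+ (2 - j))).
  apply: eq_bigr => i _; rewrite hornerZ hornerXn -polyC_exp mulrC.
  rewrite mul_polyC scaler_sumr.
  by apply: eq_bigr => j _; rewrite scalerA.
rewrite exchange_big; apply: eq_bigr => j _; rewrite -scaler_suml mxE.
by congr (_ *: _); apply: eq_bigr => i _; rewrite mxE.
Qed.

End Biquadratic.

(** * Irreducible kernels and their generic point *)

Lemma irreducible_horner_neq0 (k : fieldType) (Q : {poly {poly k}}) (z : k) :
  irreducible_elt Q -> size Q = 3%N -> Q.[z%:P] != 0.
Proof.
move=> [Q0 _ Qirr] Q3; apply/negP => /factor_theorem [g Qg].
have g0 : g != 0 by apply: contra Q0 => /eqP g0; rewrite Qg g0 mul0r.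
have g2 : size g = 2%N.
  by move: Q3; rewrite Qg size_mul ?polyXsubC_eq0 // size_XsubC addn2 => -[].
by case: (Qirr _ _ Qg); rewrite poly_unitE ?g2 ?size_XsubC.
Qed.

Lemma irreducible_swapXY (k : fieldType) (Q : {poly {poly k}}) :
  irreducible_elt Q -> irreducible_elt (swapXY Q).
Proof.
have unit_swap (g : {poly {poly k}}) :
    swapXY g \is a GRing.unit -> g \is a GRing.unit.
  by move=> gu; rewrite -[g]swapXYK; apply: rmorph_unit gu.
move=> [Q0 Qu Qirr]; split.
- by rewrite swapXY_eq0.
- by apply: contra Qu; apply: unit_swap.
- move=> g h /(congr1 swapXY); rewrite swapXYK rmorphM /= => /Qirr.
  by case=> /unit_swap; [left|right].
Qed.

Lemma det_mx22 (K : comPzRingType) (A : 'M[K]_2) :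
  \det A = A 0 0 * A 1 1 - A 0 1 * A 1 0.
Proof.
rewrite (expand_det_row _ 0) !big_ord_recl big_ord0 /cofactor !det_mx11 !mxE /=.
rewrite addr0 expr0 expr1 mul1r mulN1r mulrN.
by congr (_ * A _ _ - A _ _ * A _ _); apply: val_inj.
Qed.

(** A matrix of rank at most 1: its rows are proportional to row 0, if that row
    is nonzero. *)
Lemma cofactor_mx0_minor (K : comNzRingType) (N : 'M[K]_3) i j j' :
  cofactor_mx N = 0 -> N 0 j * N i j' = N 0 j' * N i j.
Proof.
move=> /matrixP C0.
have minor (m n : 'I_3) : N (lift m 0) (lift n 0) * N (lift m 1) (lift n 1)
             = N (lift m 0) (lift n 1) * N (lift m 1) (lift n 0).
  have := C0 m n; rewrite !mxE /cofactor det_mx22 !mxE => /(canRL (signrMK _)).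
  by rewrite mulr0 => /eqP; rewrite subr_eq0 => /eqP.
have l00 : lift 0 0 = 1 :> 'I_3 by apply: val_inj.
have l01 : lift 0 1 = 2 :> 'I_3 by apply: val_inj.
have l10 : lift 1 0 = 0 :> 'I_3 by apply: val_inj.
have l11 : lift 1 1 = 2 :> 'I_3 by apply: val_inj.
have l20 : lift 2 0 = 0 :> 'I_3 by apply: val_inj.
have l21 : lift 2 1 = 1 :> 'I_3 by apply: val_inj.
move: (minor 1 0) (minor 1 1) (minor 1 2) (minor 2 0) (minor 2 1) (minor 2 2).
rewrite !(l00, l01, l10, l11, l20, l21) => m10 m11 m12 m20 m21 m22.
by move: i j j'; apply: forall_ord3; do 2 apply: forall_ord3;
  rewrite ?m10 ?m11 ?m12 ?m20 ?m21 ?m22 // mulrC.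
Qed.

Section IrreducibleKernel.
Variables (k : closedFieldType) (M : 'M[k]_3).
Hypothesis Qirr : irreducible_elt (- biquadratic M).
Hypothesis Qdegx : size (- biquadratic M) = 3%N.

(** The curve has no vertical line as a component. *)
Lemma irreducible_mono_neq0 z : mono z *m M != 0.
Proof.
apply: contra (irreducible_horner_neq0 z Qirr Qdegx) => /eqP zM.
by rewrite hornerN horner_biquadratic zM big1 ?oppr0 // => j _; rewrite mxE scale0r.
Qed.

Lemma row0_neq0 : exists j, M 0 j != 0.
Proof.
apply: contrapT => M0.
suff : (size (biquadratic M) < 3)%N by rewrite -size_polyN Qdegx.
by apply: size_biquadratic_lt3 => j; apply: contrapT => /eqP Mj; apply: M0; exists j.
Qed.

(** Such a row is a multiple of [mono z], or of [(1, 0, 0)], the row attached to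
    [z] infinite. In the first case the curve contains the line [x = z], in the
    second the degree in [x] drops. *)
Lemma isotropic_left_kernel (u : 'rV[k]_3) :
  u *m M = 0 -> u 0 0 * u 0 2 = u 0 1 ^+ 2 -> u = 0.
Proof.
move=> uM u_iso; have [u2|u2] := eqVneq (u 0 2) 0; last first.
  have uE : u = u 0 2 *: mono (u 0 1 / u 0 2).
    apply/rowP; apply: forall_ord3; rewrite !mxE.
    - by rewrite expr_div_n -u_iso; field.
    - by field.
    - by rewrite mulr1.
  have := irreducible_mono_neq0 (u 0 1 / u 0 2); move/eqP: uM.
  by rewrite {1}uE -scalemxAl scaler_eq0 (negPf u2) /= => ->.
have u1 : u 0 1 = 0 by apply/eqP; rewrite -sqrf_eq0 -u_iso u2 mulr0.
apply/rowP; apply: forall_ord3; rewrite !mxE //.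
have [j Mj] := row0_neq0; apply: (mulIf Mj); rewrite mul0r.
by move/rowP: uM => /(_ j); rewrite mxE sum_ord3 u1 u2 !mxE !mul0r !addr0.
Qed.
End IrreducibleKernel.

Section KernelCurve.
Variables (k : closedFieldType) (M : 'M[k]_3).
Hypothesis Qirr : irreducible_elt (- biquadratic M).
Hypothesis Qdegx : size (- biquadratic M) = 3%N.
Hypothesis Qdegy : sizeY (- biquadratic M) = 3%N.

Let swapQ : swapXY (- biquadratic M) = - biquadratic M^T.
Proof. by rewrite rmorphN /= swapXY_biquadratic. Qed.

Let Qirr' : irreducible_elt (- biquadratic M^T).
Proof. by rewrite -swapQ; apply: irreducible_swapXY. Qed.

Let Qdegx' : size (- biquadratic M^T) = 3%N.
Proof. by rewrite -swapQ -sizeYE. Qed.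

Lemma col0_neq0 : exists i, M i 0 != 0.
Proof. by case: (row0_neq0 Qdegx') => i; rewrite mxE; exists i. Qed.

(** If [M] had rank at most 1, then [Q] would be a product [A(x) B(y)], and the
    curve would contain the line [y = z] for every root [z] of [B]. *)
Lemma irreducible_cofactor_neq0 : cofactor_mx M != 0.
Proof.
apply/eqP => C0; have minor := cofactor_mx0_minor _ _ _ C0.
have [j0 M0j0] := row0_neq0 Qdegx; have [i0 Mi0] := col0_neq0.
have M00 : M 0 0 != 0.
  have : M 0 j0 * M i0 0 != 0 by rewrite mulf_neq0.
  by rewrite minor mulf_eq0 negb_or => /andP[].
pose g : {poly k} := \sum_j M 0 j *: 'X^(2 - j).
have size_g : size g != 1%N.
  apply/negP => /eqP g1; case/negP: M00; apply/eqP.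
  have /(congr1 (fun h : {poly k} => h`_2)) : g = (g`_0)%:P.
    by apply: size1_polyC; rewrite g1.
  by rewrite coefC /= /g sum_ord3 !coefD !coefZ !coefXn /= mulr1 !mulr0 !addr0.
have [z /rootP gz] := closed_rootP _ size_g.
have /eqP := irreducible_mono_neq0 Qirr' Qdegx' z; apply.
apply/rowP => i; rewrite [RHS]mxE; apply: (mulfI M0j0); rewrite mulr0.
transitivity (M i j0 * g.[z]); last by rewrite gz mulr0.
rewrite mxE horner_sum !mulr_sumr; apply: eq_bigr => j _.
by rewrite !mxE hornerZ hornerXn mulrCA minor; ring.
Qed.

Variable F : function_field (- biquadratic M).
Local Notation iota := (ff_const F).
Local Notation x := (ff_x F).
Local Notation y := (ff_y F).

Lemma generic_point : mono x *m map_mx iota M *m (mono y)^T = 0.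
Proof.
apply/matrixP => i j; rewrite !ord1 [RHS]mxE -eval2_biquadratic.
by apply/ff_ker; exists (-1); rewrite mulN1r opprK.
Qed.

(** A multiple of [Q] of degree less than 2 in [x] is 0. *)
Lemma generic_eq0_x (A : 'M[k]_3) : (forall j, A 0 j = 0) ->
  mono x *m map_mx iota A *m (mono y)^T = 0 -> A = 0.
Proof.
move=> /size_biquadratic_lt3 A3 /matrixP/(_ 0 0); rewrite -eval2_biquadratic mxE.
move=> /ff_ker [g Ag]; apply: biquadratic_eq0; move: A3; rewrite Ag.
have [->|g0] := eqVneq g 0; first by rewrite mul0r.
have Q0 : - biquadratic M != 0 by case: Qirr.
rewrite size_mul // Qdegx; have : (0 < size g)%N by rewrite size_poly_gt0.
by case: (size _) => [//|n] _; rewrite addSn addnC.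
Qed.

Lemma generic_eq0_y (A : 'M[k]_3) : (forall i, A i 0 = 0) ->
  mono x *m map_mx iota A *m (mono y)^T = 0 -> A = 0.
Proof.
move=> A0; have /size_biquadratic_lt3 : forall i, A^T 0 i = 0 by move=> i; rewrite mxE.
rewrite -swapXY_biquadratic => A3 /matrixP/(_ 0 0); rewrite -eval2_biquadratic mxE.
move=> /ff_ker [g Ag]; apply: biquadratic_eq0; move: A3; rewrite Ag rmorphM /=.
have [->|g0] := eqVneq g 0; first by rewrite mul0r.
have Q0 : - biquadratic M != 0 by case: Qirr.
rewrite size_mul ?swapXY_eq0 // -[size (swapXY (- _))]sizeYE Qdegy.
have : (0 < size (swapXY g))%N by rewrite size_poly_gt0 swapXY_eq0.
by case: (size _) => [//|n] _; rewrite addSn addnC.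
Qed.

Lemma generic_bilinear (c11 c10 c01 c00 : k) :
  iota c11 * x * y + iota c10 * x + iota c01 * y + iota c00 = 0 ->
  [/\ c11 = 0, c10 = 0, c01 = 0 & c00 = 0].
Proof.
pose A := \matrix_(i < 3, j < 3)
  nth 0 (nth [::] [:: [::]; [:: 0; c11; c10]; [:: 0; c01; c00]] i) j.
move=> c0; have /matrixP A0 : A = 0.
  apply: generic_eq0_x => [j|]; first by rewrite mxE nth_nil.
  apply/matrixP => i j; rewrite !ord1 !mxE sum_ord3 !mxE !sum_ord3 !mxE /= !rmorph0.
  by rewrite -[RHS]c0; ring.
by split; [have := A0 1 1|have := A0 1 2|have := A0 2 1|have := A0 2 2]; rewrite !mxE.
Qed.

(** The case of a singular [M]. A nonzero column [u] of the cofactors is in the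
    left kernel of [M]. If the contraction of [u] with [(s - x) f(s, y)] is 0, this
    is a bilinear relation between [x] and [y], whose coefficients vanish: they say
    that the Hankel matrix [(u_0, u_1; u_1, u_2)] kills [(f_0, f_1)] and
    [(f_2, f_3)]. So this matrix is singular, which [isotropic_left_kernel]
    excludes. *)
Lemma slice_contraction_neq0 (f : 'cV[k]_4) : \det M = 0 -> f != 0 ->
  slice_mul_root (map_mx iota f) y x *m cofactor_mx (map_mx iota M) != 0.
Proof.
move=> detM0 f_neq0; apply/eqP => qC.
case/eqP: irreducible_cofactor_neq0; apply/matrixP => i0 j0; rewrite mxE [RHS]mxE.
pose u := row j0 (\adj M).
have uE i : cofactor M i j0 = u 0 i by rewrite !mxE.
have uM : u *m M = 0.
  by rewrite /u -row_mul mul_adj_mx detM0 (raddf0 scalar_mx) row0.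
suff u_iso : u 0 0 * u 0 2 = u 0 1 ^+ 2.
  by rewrite uE (isotropic_left_kernel Qirr Qdegx uM u_iso) mxE.
have /rowP/(_ j0) := qC; rewrite mxE [RHS]mxE sum_ord3 => qu.
have CE i : cofactor_mx (map_mx iota M) i j0 = iota (u 0 i).
  by rewrite mxE cofactor_map_mx uE.
(* the coefficients of [xy, x, y] and 1 in the contraction with [u] *)
have [|h11 h10 h01 h00] := @generic_bilinear
    (- (f 0 0 * u 0 1 + f 1 0 * u 0 2)) (- (f 2 0 * u 0 1 + f 3 0 * u 0 2))
    (f 0 0 * u 0 0 + f 1 0 * u 0 1) (f 2 0 * u 0 0 + f 3 0 * u 0 1).
  rewrite -[RHS]qu !CE ![slice_mul_root _ _ _ _ _]mxE /= /slice_lead /slice_const.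
  rewrite ![map_mx _ _ _ _]mxE.
  by rewrite !(rmorphN, rmorphD, rmorphM) /=; ring.
apply/eqP; rewrite -subr_eq0; apply/negPn/negP => hankel_neq0.
have hankel g0 g1 : - (g0 * u 0 1 + g1 * u 0 2) = 0 ->
    g0 * u 0 0 + g1 * u 0 1 = 0 -> g0 = 0 /\ g1 = 0.
  move=> r1 r0; split; apply: (mulIf hankel_neq0); rewrite mul0r.
    transitivity (u 0 2 * (g0 * u 0 0 + g1 * u 0 1)
       + u 0 1 * - (g0 * u 0 1 + g1 * u 0 2)); first by ring.
    by rewrite r0 r1 !mulr0 addr0.
  transitivity (- u 0 0 * - (g0 * u 0 1 + g1 * u 0 2)
       - u 0 1 * (g0 * u 0 0 + g1 * u 0 1)); first by ring.
  by rewrite r0 r1 !mulr0 subr0.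
have [f0 f1] := hankel _ _ h11 h01; have [f2 f3] := hankel _ _ h10 h00.
by case/eqP: f_neq0; apply: cV4_eq0.
Qed.

Lemma generator_morphism_eq (s s' : {rmorphism F -> F}) :
  (forall c, s (iota c) = s' (iota c)) -> s x = s' x -> s y = s' y -> s =1 s'.
Proof.
move=> sc sx sy z; have [f [g [_ ->]]] := ff_frac z.
have se (h : {poly {poly k}}) : s (eval2 iota h x y) = s' (eval2 iota h x y).
  rewrite /eval2 -!horner_map /= !map_polyC /= sx sy; congr (_.[_, _]).
  by apply/polyP => i; apply/polyP => j; rewrite !coef_map /= sc.
by rewrite !fmorph_div !se.
Qed.

Lemma generic_y_neq0 : y != 0.
Proof.
apply/eqP => y0.
case: (@generic_bilinear 0 0 1 0) => [|_ _ /eqP]; last by rewrite oner_eq0.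
by rewrite !rmorph0 rmorph1 y0; ring.
Qed.

Lemma generic_x_neq0 : x != 0.
Proof.
apply/eqP => x0.
case: (@generic_bilinear 0 1 0 0) => [|_ /eqP]; last by rewrite oner_eq0.
by rewrite !rmorph0 rmorph1 x0; ring.
Qed.

Lemma generic_affine_y (c d : 'cV[k]_3) :
  (mono x *m map_mx iota c) 0 0 * y + (mono x *m map_mx iota d) 0 0 = 0 ->
  c = 0 /\ d = 0.
Proof.
pose A := \matrix_(i < 3, j < 3) nth 0 [:: 0; c i 0; d i 0] j.
move=> cd0; have /matrixP A0 : A = 0.
  apply: generic_eq0_y => [i|]; first by rewrite mxE.
  apply/matrixP => i j; rewrite !ord1 [RHS]mxE -[RHS]cd0.
  rewrite !mxE sum_ord3 !mxE !sum_ord3 !mxE /=.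
  by rewrite !rmorph0; ring.
by split; apply/colP => i; [have := A0 i 1|have := A0 i 2]; rewrite !mxE.
Qed.

Lemma generic_affine_x (c d : 'cV[k]_3) :
  (mono y *m map_mx iota c) 0 0 * x + (mono y *m map_mx iota d) 0 0 = 0 ->
  c = 0 /\ d = 0.
Proof.
pose A := \matrix_(i < 3, j < 3) nth 0 [:: 0; c j 0; d j 0] i.
move=> cd0; have /matrixP A0 : A = 0.
  apply: generic_eq0_x => [j|]; first by rewrite mxE.
  apply/matrixP => i j; rewrite !ord1 [RHS]mxE -[RHS]cd0.
  rewrite !mxE sum_ord3 !mxE !sum_ord3 !mxE /=.
  by rewrite !rmorph0; ring.
by split; apply/colP => i; [have := A0 1 i|have := A0 2 i]; rewrite !mxE.
Qed.
End KernelCurve.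

(** * The involutions of the generic point *)

Lemma reflected_root (K : fieldType) (r : 'rV[K]_3) (t : K) :
  t != 0 -> r 0 0 != 0 -> r *m (mono t)^T = 0 ->
  r = r 0 0 *: quad t (r 0 2 / (t * r 0 0)).
Proof.
move=> t0 r0 /matrixP/(_ 0 0); rewrite !mxE sum_ord3 !mxE /= => rt.
apply/rowP; apply: forall_ord3; rewrite !mxE /=.
- by rewrite mulr1.
- apply: (mulIf t0); apply/eqP; rewrite -subr_eq0 -[X in _ == X]rt; apply/eqP.
  by field; rewrite t0 r0.
- by field; rewrite t0 r0.
Qed.

Lemma map_mono (K L : nzRingType) (f : {rmorphism K -> L}) u :
  map_mx f (mono u) = mono (f u).
Proof. by apply/rowP => i; rewrite !mxE rmorphXn. Qed.

Lemma map_quad (K L : nzRingType) (f : {rmorphism K -> L}) u v :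
  map_mx f (quad u v) = quad (f u) (f v).
Proof.
apply/rowP; apply: forall_ord3; rewrite !mxE /=.
- by rewrite rmorph1.
- by rewrite rmorphN rmorphD.
- by rewrite rmorphM.
Qed.

(** The three points are permuted by the dihedral group of order 6 as the vertices
    of a triangle, [u] being the vertex fixed by [s]. *)
Lemma braid_orbit_injective (K : eqType) (s t : K -> K) (u : K) :
  involutive s -> involutive t -> (forall z, s (t (s z)) = t (s (t z))) ->
  s u = u -> t u != u -> injective (fun i : 'I_3 => nth u [:: u; t u; s (t u)] i).
Proof.
move=> sK tK braid su tu.
have u02 : s (t u) != u by apply: contra tu => /eqP e; rewrite -[t u]sK e su.
have u12 : s (t u) != t u.
  by apply: contra tu => /eqP e; have := braid u; rewrite su e tK => ->.
have neq := (negPf tu, negPf u02, negPf u12).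
by elim/forall_ord3; elim/forall_ord3 => //= /eqP; rewrite ?neq // eq_sym neq.
Qed.

(** Both involutions are treated at once: [s] fixes [u] and moves [v] to the other
    root of the quadratic equation [r] of [v] over [u]. For [xi], the pair
    [(u, v)] is [(x, y)]; for [eta], it is [(y, x)] and [A] is transposed. The
    hypothesis [affine_eq0] excludes an equation of degree 1 for [v] over [u]. *)
Section Reflection.
Variables (k K : fieldType) (iota : {rmorphism k -> K}) (A : 'M[k]_3) (u v : K).
Hypothesis two_neq0 : (2 : k) != 0.
Hypothesis on_curve : mono u *m map_mx iota A *m (mono v)^T = 0.
Hypothesis v_neq0 : v != 0.
Hypothesis affine_eq0 : forall c d : 'cV[k]_3,
  (mono u *m map_mx iota c) 0 0 * v + (mono u *m map_mx iota d) 0 0 = 0 ->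
  c = 0 /\ d = 0.
Hypothesis col0_neq0 : exists i, A i 0 != 0.
Variable s : {rmorphism K -> K}.
Hypothesis s_const : forall c, s (iota c) = iota c.
Hypothesis s_u : s u = u.
Local Notation r := (mono u *m map_mx iota A).
Hypothesis s_v : s v = r 0 2 / (v * r 0 0).

Lemma row_mono_col j : r 0 j = (mono u *m map_mx iota (col j A)) 0 0.
Proof. by rewrite !mxE; apply: eq_bigr => i _; rewrite !mxE. Qed.

Lemma lead_neq0 : r 0 0 != 0.
Proof.
case: col0_neq0 => i; apply: contra => /eqP r0.
case: (@affine_eq0 0 (col 0 A)) => [|_ /colP/(_ i)]; last by rewrite !mxE => ->.
by rewrite -row_mono_col r0 map_mx0 mulmx0 mxE mul0r addr0.
Qed.

Lemma reflection_factor : r = r 0 0 *: quad v (s v).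
Proof. by rewrite s_v; apply: reflected_root => //; apply: lead_neq0. Qed.

(** A double root [v] would be a root of the derivative, of degree 1 in [v]. *)
Lemma reflection_neq : s v != v.
Proof.
apply/eqP => vv; case: col0_neq0 => i /negP; apply.
case: (@affine_eq0 (2 *: col 0 A) (col 1 A)) => [|/colP/(_ i)].
  rewrite map_mxZ -scalemxAr [X in X * v]mxE -!row_mono_col reflection_factor vv.
  by rewrite !mxE /= rmorph_nat; ring.
by move=> + _; rewrite !mxE => /eqP; rewrite mulf_eq0 (negPf two_neq0).
Qed.

Lemma map_row_mono (s' : {rmorphism K -> K}) w : (forall c, s' (iota c) = iota c) ->
  map_mx s' (mono w *m map_mx iota A) = mono (s' w) *m map_mx iota A.
Proof.
move=> s'_const; rewrite map_mxM map_mono; congr (_ *m _).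
by apply/matrixP => i j; rewrite !mxE s'_const.
Qed.

(** [s] fixes the equation of [v], hence permutes its roots. *)
Lemma reflectionK : s (s v) = v.
Proof.
have := map_row_mono u s_const; rewrite s_u {1}reflection_factor map_mxZ map_quad => rE.
have r0E : s (r 0 0) = r 0 0 by move/rowP/(_ 0): (rE); rewrite !mxE /= mulr1.
move: rE; rewrite r0E [RHS]reflection_factor => /(scalerI lead_neq0) /rowP/(_ 1).
by rewrite !mxE /= => /oppr_inj; rewrite addrC => /addIr.
Qed.

End Reflection.

(** * Rotations of order 3 and the determinant *)

Section Group.
Variables (k : closedFieldType) (M : 'M[k]_3).
Hypothesis two_neq0 : (2 : k) != 0.
Hypothesis Qirr : irreducible_elt (- biquadratic M).
Hypothesis Qdegx : size (- biquadratic M) = 3%N.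
Hypothesis Qdegy : sizeY (- biquadratic M) = 3%N.
Variable F : function_field (- biquadratic M).
Local Notation iota := (ff_const F).
Local Notation x := (ff_x F).
Local Notation y := (ff_y F).
Local Notation N := (map_mx iota M).
Local Notation NT := (map_mx iota M^T).
Variables xi eta : {rmorphism F -> F}.
Hypotheses (xi_const : forall c, xi (iota c) = iota c)
  (eta_const : forall c, eta (iota c) = iota c).
Hypotheses (xi_x : xi x = x) (eta_y : eta y = y).
Hypothesis xi_y : xi y = (mono x *m N) 0 2 / (y * (mono x *m N) 0 0).
Hypothesis eta_x : eta x = (mono y *m NT) 0 2 / (x * (mono y *m NT) 0 0).

Let y_neq0 : y != 0 := generic_y_neq0 Qirr Qdegx F.
Let x_neq0 : x != 0 := generic_x_neq0 Qirr Qdegx F.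
Let curve_xy : mono x *m N *m (mono y)^T = 0 := generic_point F.
Let curve_yx : mono y *m NT *m (mono x)^T = 0.
Proof. by apply: trmx_inj; rewrite !trmx_mul !trmxK -map_trmx trmxK trmx0 mulmxA. Qed.
Let affine_y := @generic_affine_y _ _ Qirr Qdegy F.
Let affine_x := @generic_affine_x _ _ Qirr Qdegx F.
Let col0 : exists i, M i 0 != 0 := col0_neq0 Qdegy.
Let row0M : exists i, M^T i 0 != 0.
Proof. by case: (row0_neq0 Qdegx) => j; exists j; rewrite mxE. Qed.

Let xiK : involutive xi.
Proof.
move=> z; apply: (generator_morphism_eq (s := xi \o xi) (s' := idfun)) => [c||] /=.
- by rewrite !xi_const.
- by rewrite !xi_x.
- exact: (reflectionK curve_xy y_neq0 affine_y col0 xi_const xi_x xi_y).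
Qed.

Let etaK : involutive eta.
Proof.
move=> z; apply: (generator_morphism_eq (s := eta \o eta) (s' := idfun)) => [c||] /=.
- by rewrite !eta_const.
- exact: (reflectionK curve_yx x_neq0 affine_x row0M eta_const eta_y eta_x).
- by rewrite !eta_y.
Qed.

Let xi_y_neq : xi y != y :=
  reflection_neq two_neq0 curve_xy y_neq0 affine_y col0 xi_y.
Let eta_x_neq : eta x != x :=
  reflection_neq two_neq0 curve_yx x_neq0 affine_x row0M eta_x.
Let factor_y : mono x *m N = (mono x *m N) 0 0 *: quad y (xi y) :=
  reflection_factor curve_xy y_neq0 affine_y col0 xi_y.
Let factor_x : mono y *m NT = (mono y *m NT) 0 0 *: quad x (eta x) :=
  reflection_factor curve_yx x_neq0 affine_x row0M eta_x.
Let lead_x : (mono x *m N) 0 0 != 0 := lead_neq0 affine_y col0.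
Let lead_y : (mono y *m NT) 0 0 != 0 := lead_neq0 affine_x row0M.

Lemma card_group_eq6_rotation :
  generated_group [set (xi : F -> F); (eta : F -> F)] #= `I_6 <->
  forall z, xi (eta (xi (eta (xi (eta z))))) = z.
Proof.
apply: card_generated_involutions_eq6 => //.
- by move=> e; case/eqP: xi_y_neq; rewrite e.
- by move=> e; case/eqP: eta_x_neq; rewrite e.
- by move=> e; case/eqP: xi_y_neq; rewrite e eta_y.
Qed.

Lemma curve_image (s : {rmorphism F -> F}) : (forall c, s (iota c) = iota c) ->
  mono (s x) *m N *m (mono (s y))^T = 0.
Proof.
move=> s_const; rewrite -map_row_mono // -map_mono map_trmx -map_mxM curve_xy.
exact: map_mx0.
Qed.

Lemma rotation_order3_det_eq0 :
  (forall z, xi (eta (xi (eta (xi (eta z))))) = z) ->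
  \det (bihankel (cofactor_mx M)) = 0.
Proof.
move=> rot3.
have braid z : xi (eta (xi z)) = eta (xi (eta z)).
  by rewrite -[RHS]rot3 !(etaK, xiK).
pose X (i : 'I_3) := nth x [:: x; eta x; xi (eta x)] i.
pose Y (i : 'I_3) := nth y [:: y; xi y; eta (xi y)] i.
have X_inj : injective X by apply: braid_orbit_injective.
have Y_inj : injective Y by apply: braid_orbit_injective => // z; rewrite braid.
have row_momentN i : row i (moment_mx X *m N) = mono (X i) *m N.
  by rewrite row_mul rowK.
apply/eqP; rewrite -(fmorph_eq0 iota) -det_map_mx map_bihankel_cofactor_mx; apply/eqP.
apply: (det_bihankel_hexagon X_inj Y_inj) => [i|i j].
  have -> : (moment_mx X *m N) i 0 = (mono (X i) *m N) 0 0.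
    by rewrite -row_momentN [RHS]mxE.
  have lead (s : {rmorphism F -> F}) : (forall c, s (iota c) = iota c) ->
      (mono (s x) *m N) 0 0 != 0.
    by move=> s_const; rewrite -map_row_mono // mxE fmorph_eq0.
  elim/forall_ord3: i; rewrite /X /=; [exact: (lead idfun)|exact: lead|].
  by apply: (lead (xi \o eta)) => c /=; rewrite eta_const.
have -> : (moment_mx X *m N *m (moment_mx Y)^T) i j =
    (mono (X i) *m N *m (mono (Y j))^T) 0 0.
  have := row_mul i (moment_mx X *m N) (moment_mx Y)^T.
  rewrite row_momentN => /rowP/(_ j).
  rewrite mxE => ->; rewrite ![in LHS]mxE [RHS]mxE; apply: eq_bigr => l _.
  by rewrite !mxE.
suff curve : i != rev_ord j -> mono (X i) *m N *m (mono (Y j))^T = 0.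
  by move=> ?; rewrite curve // mxE.
have xe_const c : (xi \o eta) (iota c) = iota c by rewrite /= eta_const.
have ex_const c : (eta \o xi) (iota c) = iota c by rewrite /= xi_const.
have xex_const c : (xi \o eta \o xi) (iota c) = iota c by rewrite /= xi_const eta_const.
(* the vertices other than [(x, y)], as images by xi, eta, eta xi, xi eta, xi eta xi *)
move: i j; elim/forall_ord3; elim/forall_ord3 => // _; rewrite /X /Y /=.
- by rewrite -{1}xi_x; apply: curve_image.
- by rewrite -{1}eta_y; apply: curve_image.
- by have := curve_image ex_const; rewrite /= xi_x.
- by have := curve_image xe_const; rewrite /= eta_y.
- by have := curve_image xex_const; rewrite /= xi_x braid eta_y.
Qed.

Lemma det_eq0_rotation_order3 : \det (bihankel (cofactor_mx M)) = 0 ->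
  forall z, xi (eta (xi (eta (xi (eta z))))) = z.
Proof.
move=> det0.
have [f f_neq0 Mf] : exists2 f : 'cV[k]_4, f != 0 & bihankel (cofactor_mx M) *m f = 0.
  have /eqP/det0P [g g0 gM] : \det (bihankel (cofactor_mx M))^T = 0 by rewrite det_tr.
  exists g^T; first by rewrite -trmx0 (inj_eq trmx_inj).
  by apply: trmx_inj; rewrite trmx_mul trmxK gM trmx0.
have Nf : bihankel (cofactor_mx N) *m map_mx iota f = 0.
  by rewrite -map_bihankel_cofactor_mx -map_mxM Mf map_mx0.
have f_eq0 : f 0 0 = 0 -> f 1 0 = 0 -> f 2 0 = 0 -> f 3 0 = 0 -> False.
  by move=> f0 f1 f2 f3; case/eqP: f_neq0; apply: cV4_eq0.
have Nxi : N *m (mono (xi y))^T = xi ((mono y *m NT) 0 0) *: (quad x (xi (eta x)))^T.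
  have := map_row_mono M^T y xi_const; rewrite {1}factor_x map_mxZ map_quad xi_x.
  move/(congr1 (@trmx _ _ _)); rewrite trmx_mul linearZ /= => ->.
  by rewrite -map_trmx trmxK.
have [delta [qC detq]] := det_contracted Nf lead_x factor_y Nxi.
have beta_neq0 : xi ((mono y *m NT) 0 0) != 0 by rewrite fmorph_eq0.
move: qC detq; set x2 := xi (eta x); set beta := xi _ in beta_neq0 * => qC detq.
set lead := slice_lead (map_mx iota f) y; set cst := slice_const (map_mx iota f) y.
have detq0 : \det N * lead = delta * beta.
  by have /rowP/(_ 0) := detq; rewrite !mxE /= mulr1.
have detq1 : \det N * (cst - x * lead) = - (delta * beta * (x + x2)).
  by have /rowP/(_ 1) := detq; rewrite !mxE /= mulrN.
have leadE : lead = iota (f 0 0) * y + iota (f 2 0) by rewrite /lead /slice_lead !mxE.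
have cstE : cst = iota (f 1 0) * y + iota (f 3 0) by rewrite /cst /slice_const !mxE.
have [detN0|detN_neq0] := eqVneq (\det N) 0.
  have delta0 : delta = 0.
    apply/eqP; move/esym/eqP: detq0.
    by rewrite detN0 mul0r mulf_eq0 (negPf beta_neq0) orbF.
  have detM0 : \det M = 0.
    by apply/eqP; rewrite -(fmorph_eq0 iota) -det_map_mx detN0.
  have := slice_contraction_neq0 Qirr Qdegx Qdegy F detM0 f_neq0.
  by rewrite qC delta0 scale0r eqxx.
(* [f(x2, y) = 0], comparing the roots of the two quadratic polynomials *)
have rel : lead * x2 + cst = 0.
  apply: (mulfI detN_neq0); rewrite mulr0 mulrDr mulrA detq0.
  have -> : \det N * cst = \det N * (cst - x * lead) + x * (\det N * lead) by ring.
  by rewrite detq1 detq0; ring.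
have slice_lead_neq0 : lead != 0.
  apply/eqP => lead0; move: rel; rewrite lead0 mul0r add0r cstE => cst0.
  move: lead0; rewrite leadE => lead0.
  case: (@generic_bilinear _ _ Qirr Qdegx F 0 0 (f 0 0) (f 2 0)) => [|_ _ f0 f2].
    by rewrite -[RHS]lead0 !rmorph0; ring.
  case: (@generic_bilinear _ _ Qirr Qdegx F 0 0 (f 1 0) (f 3 0)) => [|_ _ f1 f3].
    by rewrite -[RHS]cst0 !rmorph0; ring.
  exact: f_eq0.
(* [eta] fixes [y], and [y] determines [x2] by [f(x2, y) = 0]. *)
have eta_x2 : eta x2 = x2.
  have : lead * eta x2 + cst = 0.
    have := congr1 eta rel; rewrite rmorph0 rmorphD rmorphM leadE cstE.
    by rewrite !rmorphD !rmorphM /= !eta_const eta_y.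
  by rewrite -[RHS]rel => /addIr /(mulfI slice_lead_neq0).
have rot_x : xi (eta (xi (eta (xi (eta x))))) = x.
  by rewrite -/x2 eta_x2 /x2 xiK etaK xi_x.
apply: (generator_morphism_eq (s := xi \o eta \o (xi \o eta) \o (xi \o eta))
  (s' := idfun)) => [c||] //=.
  by rewrite !(eta_const, xi_const).
pose rot z := xi (eta (xi (eta (xi (eta z))))); rewrite -/(rot y).
have rot_x2 : rot x2 = x2.
  by rewrite /rot /x2 rot_x.
(* The rotation cubed fixes [x2], which determines [y] by the same equation. *)
pose lead' := iota (f 0 0) * x2 + iota (f 1 0).
pose cst' := iota (f 2 0) * x2 + iota (f 3 0).
have rel' : lead' * y + cst' = 0.
  by rewrite -[RHS]rel leadE cstE /lead' /cst'; ring.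
have : lead' * rot y + cst' = 0.
  have : rot (lead' * y + cst') = 0 by rewrite rel' /rot !rmorph0.
  have rotE :
      rot = (xi \o eta \o (xi \o eta) \o (xi \o eta) : {rmorphism F -> F}) by [].
  rewrite rotE /lead' /cst' !(rmorphD, rmorphM) -rotE rot_x2.
  have rot_const c : rot (iota c) = iota c by rewrite /rot !(eta_const, xi_const).
  by rewrite !rot_const.
have affine_x2 c d : iota c * x2 + iota d = 0 -> c = 0 /\ d = 0.
  have xe e : xi (eta (iota e)) = iota e by rewrite eta_const.
  rewrite /x2 -(xe c) -(xe d).
  rewrite -!(rmorphM, rmorphD) => /eqP; rewrite !fmorph_eq0 => /eqP cd0.
  case: (@generic_bilinear _ _ Qirr Qdegx F 0 c 0 d) => [|_ -> _ ->//].
  by rewrite -[RHS]cd0 !rmorph0; ring.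
have lead'_neq0 : lead' != 0.
  apply/eqP => lead'0; move: rel'; rewrite lead'0 mul0r add0r.
  by case/affine_x2: lead'0 => f0 f1 /affine_x2 [f2 f3]; apply: f_eq0.
by rewrite -[RHS]rel' => /addIr /(mulfI lead'_neq0).
Qed.

Lemma card_group_eq6_det :
  generated_group [set (xi : F -> F); (eta : F -> F)] #= `I_6 <->
  \det (bihankel (cofactor_mx M)) = 0.
Proof.
split=> [/card_group_eq6_rotation/rotation_order3_det_eq0 //|].
by move/det_eq0_rotation_order3/card_group_eq6_rotation.
Qed.
End Group.

(** * The kernel of the random walk *)

Section Kernel.
Variable R : realType.
Implicit Type p : 'I_3 -> 'I_3 -> R.

Definition complex_jump_mx p : 'M[R[i]]_3 := map_mx (real_complex R) (jump_matrix p).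

Lemma kernel_polyE p : kernel_poly p = - biquadratic (complex_jump_mx p).
Proof.
pose d (i j : 'I_3) : R[i] := ((i == 1) && (j == 1))%:R.
have -> : biquadratic (complex_jump_mx p) =
    \sum_(i < 3) (\sum_(j < 3) ((p i j)%:C%C - d i j) *: 'X ^+ j) *: 'X ^+ i.
  have rev_exp (i : 'I_3) : (2 - rev_ord i)%N = i by case: i => -[|[|[|]]].
  have rev_eq1 (i : 'I_3) : (rev_ord i == 1) = (i == 1) by case: i => -[|[|[|]]].
  rewrite /biquadratic (reindex_inj (@rev_ord_inj 3)); apply: eq_bigr => i _.
  rewrite (reindex_inj (@rev_ord_inj 3)) rev_exp; congr (_ *: _).
  apply: eq_bigr => j _; rewrite rev_exp !mxE !rev_ordK !rev_eq1 /d.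
  by rewrite rmorphB /= rmorph_nat.
rewrite -sumrN /kernel_poly.
have -> : 'X * 'Y = \sum_(i < 3) (\sum_(j < 3) d i j *: 'X ^+ j) *: 'X ^+ i
    :> {poly {poly R[i]}}.
  rewrite !sum_ord3 /d /= !scale0r !add0r !addr0 !scale0r !scale1r add0r addr0 expr1.
  by rewrite -mul_polyC mulrC.
rewrite -sumrB; apply: eq_bigr => i _.
have -> : \sum_(j < 3) (p i j)%:C%C%:P%:P * 'X ^+ i * 'Y ^+ j =
    (\sum_(j < 3) (p i j)%:C%C *: 'X ^+ j) *: 'X ^+ i.
  rewrite scaler_suml; apply: eq_bigr => j _.
  by rewrite -!mul_polyC polyCM [in RHS]polyC_exp mulrAC.
rewrite -scalerBl -sumrB -scaleNr -sumrN; congr (_ *: _); apply: eq_bigr => j _.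
by rewrite scalerBl opprB.
Qed.

Lemma kernel_a_mono p (K : fieldType) (iota : {rmorphism R[i] -> K}) x :
  (map_poly iota (kernel_a p)).[x] = (mono x *m map_mx iota (complex_jump_mx p)) 0 0.
Proof.
rewrite mxE (reindex_inj (@rev_ord_inj 3)) rmorph_sum horner_sum /=.
apply: eq_bigr => i _.
rewrite map_polyZ map_polyXn !hornerE !mxE /= rev_ordK andbF subr0 mulrC.
congr (_ ^+ _ * iota (p _ _)%:C%C); first by case: i => -[|[|[|]]].
exact: val_inj.
Qed.

Lemma kernel_c_mono p (K : fieldType) (iota : {rmorphism R[i] -> K}) x :
  (map_poly iota (kernel_c p)).[x] = (mono x *m map_mx iota (complex_jump_mx p)) 0 2.
Proof.
rewrite mxE (reindex_inj (@rev_ord_inj 3)) rmorph_sum horner_sum /=.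
apply: eq_bigr => i _.
rewrite map_polyZ map_polyXn !hornerE !mxE /= rev_ordK andbF subr0 mulrC.
congr (_ ^+ _ * iota (p _ _)%:C%C); first by case: i => -[|[|[|]]].
exact: val_inj.
Qed.

(** Exchanging the roles of [x] and [y] turns [a] and [c] into [kernel_ta] and
    [kernel_tc]. *)
Lemma complex_jump_mx_tr p : complex_jump_mx (fun i j => p j i) = (complex_jump_mx p)^T.
Proof. by apply/matrixP => i j; rewrite !mxE andbC. Qed.
End Kernel.

Theorem proposition2p8 (R : realType) (p : 'I_3 -> 'I_3 -> R)
    (hp : is_jump_distribution p)
    (Q_irr : irreducible_elt (kernel_poly p))
    (Q_degx : size (kernel_poly p) = 3%N)
    (Q_degy : sizeY (kernel_poly p) = 3%N)
    (F : function_field (kernel_poly p))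
    (genus1 : has_genus (ff_const F) 1)
    (xi eta : {rmorphism F -> F}) (hxi : is_xi xi) (heta : is_eta eta) :
  generated_group [set (xi : F -> F); (eta : F -> F)] #= `I_6 <->
  \det (order6_matrix p) = 0.
Proof.
pose M := complex_jump_mx p.
have -> : \det (order6_matrix p) = 0 <-> \det (bihankel (cofactor_mx M)) = 0.
  rewrite -map_bihankel_cofactor_mx det_map_mx order6_matrixE.
  by split=> [->|/eqP]; [exact: rmorph0|rewrite fmorph_eq0 => /eqP].
case: hxi heta => [[_ xi_const] xi_x xi_y] [[_ eta_const] eta_y eta_x].
rewrite kernel_c_mono kernel_a_mono -/M in xi_y.
have tcE : kernel_tc p = kernel_c (fun i j => p j i) by [].
have taE : kernel_ta p = kernel_a (fun i j => p j i) by [].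
rewrite tcE taE in eta_x.
rewrite kernel_c_mono kernel_a_mono complex_jump_mx_tr -/M in eta_x.
have two_neq0 : (2 : R[i]) != 0 by rewrite pnatr_eq0.
clear genus1 hp.
move: Q_irr Q_degx Q_degy F xi eta xi_const xi_x xi_y eta_const eta_y eta_x.
rewrite kernel_polyE -/M.
move=> Q_irr Q_degx Q_degy F xi eta xi_const xi_x xi_y eta_const eta_y eta_x.
exact: card_group_eq6_det.
Qed.
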